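(* Let $T\ge 2$ and $n\ge 2$ be integers, and let $V$ be the value of the periodic patrolling game on the line graph $L_n$ with period $T$ and attack duration $2$. Let $\mathcal{C}$ be the covering number of $L_n$. If $T$ is even, then $$V=\frac{1}{\mathcal{C}}=\begin{cases}\dfrac{2}{n} & \text{if } n \text{ is even},\\[2mm] \dfrac{2}{n+1} & \text{if } n \text{ is odd}.\end{cases}$$ If $T$ is odd and $n$ is even, then $$V=\frac{2T-1}{nT}.$$
   Context: The line graph $L_n$ is the graph with node set $\{1,2,\dots,n\}$ and edges $\{i,i+1\}$ for $i=1,\dots,n-1$ (the path on $n$ nodes). The covering number $\mathcal{C}$ of a graph is the minimum cardinality of a set of edges such that every node is incident to at least one edge of the set. The periodic patrolling game on a graph $Q$ with node set $N$, period $T$ and attack duration $2$ is the following finite zero-sum game. Times form the time circle $\{1,2,\dots,T\}$ with arithmetic modulo $T$. A pure strategy of the Patroller (a patrol) is a walk $w:\{1,2,\ldots\}\to N$ such that $w(t)$ and $w(t+1)$ are the same or adjacent nodes and $w(t+T)=w(t)$ for all $t$. A pure strategy of the Attacker is a pair consisting of a node $i\in N$ and an attack interval $J=\{t,t+1\}$ of two consecutive times (modulo $T$). The patrol $w$ intercepts the attack if $w(s)=i$ for some $s\in J$; the payoff (to the Patroller, who maximizes; the Attacker minimizes) is $1$ if the attack is intercepted and $0$ otherwise. Both players may use mixed strategies; $V$ is the value of the game (expected payoff under optimal play). *)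

(* Defs.v *)
From HB Require Import structures.
From mathcomp Require Import all_boot all_order all_algebra.

Set Implicit Arguments.
Unset Strict Implicit.
Unset Printing Implicit Defensive.

Import Order.TTheory GRing.Theory Num.Theory.
Local Open Scope ring_scope.

(* The maximizer chooses a in A, the minimizer chooses b in B, and the
   minimizer pays u a b. *)
Section ZeroSumGame.

Variables (R : realFieldType) (A B : finType) (u : A -> B -> R).

Definition mixed_strategy (S : finType) (p : {ffun S -> R}) : Prop :=
  (forall s, 0 <= p s) /\ \sum_s p s = 1.

Definition expected_payoff (p : {ffun A -> R}) (q : {ffun B -> R}) : R :=
  \sum_a \sum_b p a * q b * u a b.

Definition optimal_play (p : {ffun A -> R}) (q : {ffun B -> R}) : Prop :=
  [/\ mixed_strategy p,
      mixed_strategy q,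
      forall p', mixed_strategy p' ->
        expected_payoff p' q <= expected_payoff p q
    & forall q', mixed_strategy q' ->
        expected_payoff p q <= expected_payoff p q'].

Definition game_value (V : R) : Prop :=
  exists p q, optimal_play p q /\ V = expected_payoff p q.

End ZeroSumGame.

(* A simple graph is given by its adjacency relation, which is meant to be
   symmetric and irreflexive. *)
Section Covering.

Variables (N : finType) (adj : rel N).

Definition edges : {set {set N}} :=
  [set [set x; y] | x in N, y in N & adj x y].

Definition edge_cover (F : {set {set N}}) : bool :=
  (F \subset edges) && [forall x, exists E in F, x \in E].

(* A graph with an isolated node has no edge cover; the value is then the
   junk value #|edges|. *)
Definition covering_number : nat :=
  #|[arg min_(F < edges | edge_cover F) #|F| ]|.

End Covering.

Section PatrollingGame.

Variables (N : finType) (adj : rel N) (T : nat).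

(* The time circle is 'I_T with cyclic successor ordS (times 0, ..., T-1
   instead of 1, ..., T).  A T-periodic walk is the same thing as a function
   on the time circle whose values at t and ordS t are equal or adjacent. *)
Definition is_patrol (w : {ffun 'I_T -> N}) : bool :=
  [forall t, (w t == w (ordS t)) || adj (w t) (w (ordS t))].

Definition patrol : finType := {w : {ffun 'I_T -> N} | is_patrol w}.

(* (i, t) is the attack at node i during the interval {t, ordS t}. *)
Definition attack : finType := (N * 'I_T)%type.

Definition intercepts (w : patrol) (a : attack) : bool :=
  [exists s in [set a.2; ordS a.2], val w s == a.1].

Definition patrol_payoff (R : realFieldType) (w : patrol) (a : attack) : R :=
  (intercepts w a)%:R.

Definition patrolling_game_value (R : realFieldType) (V : R) : Prop :=
  game_value (@patrol_payoff R) V.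

End PatrollingGame.

(* Nodes are numbered 0, ..., n-1. *)
Definition line_graph (n : nat) : rel 'I_n :=
  fun i j => (j == i.+1 :> nat) || (i == j.+1 :> nat).

(* Main.v *)
Require Import Defs.
From HB Require Import structures.
From mathcomp Require Import all_boot all_order all_algebra.
From mathcomp Require Import zify.

Set Implicit Arguments.
Unset Strict Implicit.
Unset Printing Implicit Defensive.

Import Order.TTheory GRing.Theory Num.Theory.
Local Open Scope ring_scope.

(** In each case an explicit pair of optimal strategies certifies the value.
    Both are uniform distributions over families with the same number of
    members.

    T even: the Patroller oscillates on a random edge of a minimum edge cover,
    and so intercepts every attack at either end; the Attacker attacks at a
    random node 0, 2, 4, ... during one fixed interval, in which a patrol sees
    at most one of these nodes.

    T odd, n even: the Patroller takes a random edge of the perfect matching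
    and oscillates on it, pausing once per period at a random time and end, so
    that out of the 2T patrols on the edge a given attack escapes only one.
    The Attacker chooses node and time uniformly.  The path is bipartite, so a
    closed walk of odd length pauses at least once and a patrol intercepts at
    most 2T - 1 of the nT attacks. *)

(** * Certifying the value of a zero-sum game by a saddle point *)

Section Saddle.

Variables (R : realFieldType) (A B : finType) (u : A -> B -> R).

Lemma expected_payoff_ge (p : {ffun A -> R}) (q : {ffun B -> R}) v :
  mixed_strategy q -> (forall b, v <= \sum_a p a * u a b) ->
  v <= expected_payoff u p q.
Proof.
case=> q_ge0 q1 pv; rewrite /expected_payoff exchange_big /=.
rewrite -[v]mul1r -q1 mulr_suml; apply: ler_sum => b _.
under eq_bigr do rewrite mulrAC mulrC.
by rewrite -mulr_sumr ler_wpM2l.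
Qed.

Lemma expected_payoff_le (p : {ffun A -> R}) (q : {ffun B -> R}) v :
  mixed_strategy p -> (forall a, \sum_b q b * u a b <= v) ->
  expected_payoff u p q <= v.
Proof.
case=> p_ge0 p1 qv; rewrite /expected_payoff -[v]mul1r -p1 mulr_suml.
apply: ler_sum => a _; under eq_bigr do rewrite -mulrA.
by rewrite -mulr_sumr ler_wpM2l.
Qed.

(** Uniqueness: in any optimal pair, deviating to [q] gives payoff at most [v], and deviating to [p]
    gives at least [v]. *)
Lemma game_value_saddle (p : {ffun A -> R}) (q : {ffun B -> R}) v V :
  mixed_strategy p -> mixed_strategy q ->
  (forall b, v <= \sum_a p a * u a b) -> (forall a, \sum_b q b * u a b <= v) ->
  game_value u V <-> V = v.
Proof.
move=> mp mq pv qv.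
have epq : expected_payoff u p q = v.
  by apply/le_anti; rewrite expected_payoff_ge ?expected_payoff_le.
split=> [[p' [q' [[mp' mq' maxp' minq'] ->]]]|->].
  apply/le_anti/andP; split.
    by apply: le_trans (minq' _ mq) _; exact: expected_payoff_le.
  by apply: le_trans (maxp' _ mp); exact: expected_payoff_ge.
exists p, q; split; last by [].
split=> // [p' mp'|q' mq']; rewrite epq.
  exact: expected_payoff_le.
exact: expected_payoff_ge.
Qed.

End Saddle.

(** * Uniform mixtures over indexed families *)

Section Uniform.

Variables (R : realFieldType) (I S : finType) (f : I -> S).

(** The image under [f] of the uniform law on [I]; repeated values count with multiplicity, so [f]
    may fail to be injective. *)
Definition uniform : {ffun S -> R} :=
  [ffun s => \sum_i (f i == s)%:R / #|I|%:R].

Lemma sum_uniform (F : S -> R) :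
  \sum_s uniform s * F s = (\sum_i F (f i)) / #|I|%:R.
Proof.
rewrite mulr_suml; under eq_bigr do rewrite ffunE mulr_suml.
rewrite exchange_big /=; apply: eq_bigr => i _.
rewrite (bigD1 (f i)) //= eqxx mul1r mulrC big1 ?addr0 // => s.
by rewrite eq_sym => /negPf ->; rewrite !mul0r.
Qed.

Lemma mixed_uniform : (0 < #|I|)%N -> mixed_strategy uniform.
Proof.
move=> I_gt0; split=> [s|].
  by rewrite ffunE; apply: sumr_ge0 => i _; rewrite divr_ge0.
under eq_bigr do rewrite -[uniform _]mulr1.
by rewrite sum_uniform sumr_const divff // pnatr_eq0 -lt0n.
Qed.

End Uniform.

(** With one index type for both players, the two bounds share a denominator and optimality becomes
    a count in [nat]. *)
Lemma game_value_uniform (R : realFieldType) (A B I : finType)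
    (r : A -> B -> bool) (f : I -> A) (g : I -> B) (c : nat) (V : R) :
  (0 < #|I|)%N ->
  (forall b, c <= \sum_i r (f i) b)%N -> (forall a, \sum_i r a (g i) <= c)%N ->
  game_value (fun a b => (r a b)%:R) V <-> V = c%:R / #|I|%:R.
Proof.
move=> I_gt0 fc gc.
have I_inv : 0 < #|I|%:R^-1 :> R by rewrite invr_gt0 ltr0n.
apply: (@game_value_saddle _ _ _ _ (uniform R f) (uniform R g));
  try exact: mixed_uniform.
- by move=> b; rewrite sum_uniform ler_pM2r // -natr_sum ler_nat.
- by move=> a; rewrite sum_uniform ler_pM2r // -natr_sum ler_nat.
Qed.

Lemma sum_nat_of_bool (I : finType) (P : pred I) : (\sum_i P i = #|P|)%N.
Proof. by rewrite -sum1_card [RHS]big_mkcond. Qed.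

Lemma sum_nat_neq_const (I : finType) (i : I) c :
  (\sum_(j | j != i) c = #|I|.-1 * c)%N.
Proof. by rewrite -(cardC1 i) -sum_nat_const. Qed.

(** * The path: even nodes, mates and the covering number *)

Section Line.

Variable n : nat.

Lemma line_graph_sym : symmetric (@line_graph n).
Proof. by move=> i j; rewrite /line_graph orbC. Qed.

Lemma line_graph_odd (i j : 'I_n) : line_graph i j -> odd i (+) odd j.
Proof. by rewrite /line_graph => /orP[] /eqP ->; rewrite /= ?addbN ?addNb addbb. Qed.

Fact even_node_subproof (k : 'I_(uphalf n)) : (k.*2 < n)%N.
Proof. have := ltn_ord k; lia. Qed.

Definition even_node (k : 'I_(uphalf n)) : 'I_n := Ordinal (even_node_subproof k).

(** Distinct even nodes are at distance at least 2. This bounds both edge covers and what a patrol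
    sees in one interval. *)
Lemma adj_even_node_eq (i j : 'I_n) (k l : 'I_(uphalf n)) :
  (i == j) || line_graph i j ->
  even_node k \in [:: i; j] -> even_node l \in [:: i; j] -> k = l.
Proof.
rewrite !inE /line_graph -!val_eqE /= => H1 H2 H3; apply/val_inj => /=; lia.
Qed.

Hypothesis n_gt1 : (1 < n)%N.

(* For odd n the last node n-1 has no partner in the matching {0,1}, {2,3},
   ... and is sent to its only neighbour n-2. *)
Fact mate_subproof (i : 'I_n) :
  ((if ~~ odd i && (i.+1 < n) then i.+1 else i.-1) < n)%N.
Proof. by have := ltn_ord i; case: ifP => [/andP[]|_] //; lia. Qed.

Definition mate (i : 'I_n) : 'I_n := Ordinal (mate_subproof i).

Lemma adj_mate i : line_graph i (mate i).
Proof. by rewrite /line_graph /=; have := ltn_ord i; case: ifP; lia. Qed.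

Lemma half_node_cover (i : 'I_n) :
  exists k, i = even_node k \/ i = mate (even_node k).
Proof.
have lt_k : (i./2 < uphalf n)%N by have := ltn_ord i; lia.
exists (Ordinal lt_k); case: (boolP (odd i)) => oi; [right | left];
  apply/val_inj => /=; have := ltn_ord i; try case: ifP; lia.
Qed.

Lemma mateK : ~~ odd n -> involutive mate.
Proof.
move=> even_n i; apply/val_inj => /=; have := ltn_ord i.
by do 2!case: ifP; lia.
Qed.

Lemma mate_neq i : mate i != i.
Proof. by rewrite -val_eqE /=; have := ltn_ord i; case: ifP; lia. Qed.

Lemma covering_number_line : covering_number (@line_graph n) = uphalf n.
Proof.
have edgeP (i : 'I_n) : [set i; mate i] \in edges (@line_graph n).
  by apply/imset2P; exists i (mate i); rewrite ?inE ?adj_mate.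
(* The default of the [arg min] must itself be a cover. *)
have coverT : edge_cover (@line_graph n) (edges (@line_graph n)).
  rewrite /edge_cover subxx; apply/forallP => i; apply/existsP.
  by exists [set i; mate i]; rewrite edgeP !inE eqxx.
rewrite /covering_number; case: arg_minnP => // F cF minF.
apply/eqP; rewrite eqn_leq; apply/andP; split.
  pose M := [set [set even_node k; mate (even_node k)] | k : 'I_(uphalf n)].
  apply: leq_trans (minF M _) _; last first.
    by apply: leq_trans (leq_imset_card _ _) _; rewrite card_ord.
  apply/andP; split; first by apply/subsetP => E /imsetP[k _ ->].
  apply/forallP => i; apply/existsP; have [k ik] := half_node_cover i.
  exists [set even_node k; mate (even_node k)]; apply/andP.
  split; first exact: imset_f.
  rewrite !inE.
  by case: ik => <-; rewrite eqxx ?orbT.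
have /andP[/subsetP sF /forallP covF] := cF.
(* Lower bound: choose in [F] an edge at each even node; no edge holds two of them, so the choice is
   injective. *)
have /fin_all_exists[c cP] : forall k, exists E, (E \in F) && (even_node k \in E).
  by move=> k; apply/existsP/covF.
have c_inj : injective c.
  move=> k l ckl; have /andP[cF' kc] := cP k; have /andP[_ lc] := cP l.
  have /imset2P[i j _ ij Ec] := sF _ cF'.
  move: ij; rewrite inE /= => ij; apply: (@adj_even_node_eq i j).
  - by rewrite ij orbT.
  - by move: kc; rewrite Ec !inE.
  - by move: lc; rewrite -ckl Ec !inE.
rewrite -[uphalf n]card_ord -(card_image c_inj); apply/subset_leq_card/subsetP.
by move=> E /imageP[k _ ->]; have /andP[] := cP k.
Qed.

(** * Oscillating patrols and interception counts *)

Section Patrols.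

Variable T : nat.
Hypothesis T_gt1 : (1 < T)%N.

(** Time elapsed from [s] to [t] around the circle. *)
Definition phase (s t : 'I_T) : nat := ((t + (T - s)) %% T)%N.

Lemma phase_ordS s t : phase s (ordS t) = ((phase s t).+1 %% T)%N.
Proof. by rewrite /phase /= modnDml addSn -[(_ %% _).+1]addn1 modnDml addn1. Qed.

(** The phase grows by 1 except when it wraps from [T.-1] to 0, on arrival at [s]; the wrap keeps
    parity exactly when [T] is odd. *)
Lemma odd_phase_ordS s t :
  odd (phase s t) (+) odd (phase s (ordS t)) || (odd T && (s == ordS t)).
Proof.
have ltp : (phase s t < T)%N by rewrite ltn_mod; lia.
rewrite phase_ordS; have [lt|ge] := ltnP (phase s t).+1 T.
  by rewrite modn_small //= addbN addbb.
have E : (phase s t).+1 = T by lia.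
rewrite E modnn /= addbF.
have -> : odd T = ~~ odd (phase s t) by rewrite -E.
case: odd => //=; rewrite -val_eqE /=.
have : phase s (ordS t) = 0%N by rewrite phase_ordS E modnn.
rewrite /phase /=; set x := (t.+1 %% T)%N.
have : (x < T)%N by rewrite ltn_mod; lia.
have := ltn_ord s => lts ltx /eqP; have [le|gt] := leqP s x.
  rewrite (_ : x + (T - s) = (x - s) + T)%N ?modnDr; last lia.
  by rewrite modn_small; lia.
by rewrite modn_small; lia.
Qed.

(** For odd [T] the pause is at [i], over the interval that ends at [s]. *)
Definition oscillation_fun (i : 'I_n) (s : 'I_T) : {ffun 'I_T -> 'I_n} :=
  [ffun t => if odd (phase s t) then mate i else i].

Lemma is_patrol_oscillation i s :
  is_patrol (@line_graph n) (oscillation_fun i s).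
Proof.
apply/forallP => t; rewrite !ffunE.
by case: odd; case: odd; rewrite ?eqxx // ?(line_graph_sym (mate i)) adj_mate orbT.
Qed.

Definition oscillation i s : patrol (@line_graph n) T :=
  exist _ (oscillation_fun i s) (is_patrol_oscillation i s).

Lemma interceptsE (w : patrol (@line_graph n) T) (a : attack 'I_n T) :
  intercepts w a = (a.1 \in [:: val w a.2; val w (ordS a.2)]).
Proof.
rewrite !inE ![a.1 == _]eq_sym; apply/existsP/orP => [[s]|].
  by rewrite !inE => /andP[/orP[] /eqP ->]; [left | right].
by case=> H; [exists a.2 | exists (ordS a.2)]; rewrite !inE eqxx ?orbT.
Qed.

Lemma oscillation_base i s t : intercepts (oscillation i s) (i, t).
Proof.
rewrite interceptsE !inE /= !ffunE; have := odd_phase_ordS s t.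
(* During the pause the later time is [s], of phase 0, so the patrol is at [i]. *)
have : (odd T && (s == ordS t)) ==> ~~ odd (phase s (ordS t)).
  apply/implyP => /andP[_ /eqP ->]; rewrite /phase /= subnKC ?modnn //.
  by rewrite ltnW // ltn_mod; lia.
by case: (odd (phase s t)); case: (odd (phase s (ordS t)));
  rewrite ?eqxx ?orbT //= implybF => /negPf ->.
Qed.

Lemma oscillation_mate i s t :
  ~~ (odd T && (s == ordS t)) -> intercepts (oscillation i s) (mate i, t).
Proof.
move=> /negPf pause; rewrite interceptsE !inE /= !ffunE.
have := odd_phase_ordS s t; rewrite pause orbF.
by case: (odd (phase s t)); case: (odd (phase s (ordS t))); rewrite ?eqxx ?orbT.
Qed.

Lemma patrol_step (w : patrol (@line_graph n) T) t :
  (val w t == val w (ordS t)) || line_graph (val w t) (val w (ordS t)).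
Proof. exact: (forallP (valP w)). Qed.

(** Without a pause the node parity would flip [T] times around the circle, but the exclusive or of
    all flips telescopes to [false]. *)
Lemma odd_period_pause (w : patrol (@line_graph n) T) :
  odd T -> exists t, val w t == val w (ordS t).
Proof.
move=> oT; apply/existsP; apply: contraLR oT; rewrite negb_exists => /forallP nw.
have flip t : odd (val w t) (+) odd (val w (ordS t)) = true.
  by apply: line_graph_odd; move: (patrol_step w t); rewrite (negPf (nw t)).
have : \big[addb/false]_(t < T) (odd (val w t) (+) odd (val w (ordS t))) = odd T.
  under eq_bigr do rewrite flip.
  by rewrite big_const_ord; elim: (T) => //= m ->.
rewrite big_split /= [X in X (+) _](reindex (@ordS T)) /=; first by rewrite addbb => <-.
exact: onW_bij (@ordS_bij T).
Qed.

Lemma sum_intercepts_slice (w : patrol (@line_graph n) T) t :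
  (\sum_i intercepts w (i, t) <= 1 + (val w t != val w (ordS t)))%N.
Proof.
under eq_bigr do rewrite interceptsE /=.
rewrite sum_nat_of_bool; case: eqVneq => [->|_]; last exact: card_size.
by apply/card_le1_eqP => i j; rewrite !inE !orbb => /eqP -> /eqP ->.
Qed.

Lemma sum_intercepts_even_node (w : patrol (@line_graph n) T) t :
  (\sum_k intercepts w (even_node k, t) <= 1)%N.
Proof.
rewrite sum_nat_of_bool; apply/card_le1_eqP => k l.
rewrite -!topredE /= !interceptsE => kw lw.
exact: adj_even_node_eq (patrol_step w t) lw kw.
Qed.

(** Each interval contributes at most 2, and one with a pause at most 1. *)
Lemma sum_intercepts (w : patrol (@line_graph n) T) :
  odd T -> (\sum_a intercepts w a <= (2 * T).-1)%N.
Proof.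
move=> oT; rewrite -(pair_bigA _ (fun i t => intercepts w (i, t) : nat)) /=.
rewrite exchange_big /=.
have [t wt] := odd_period_pause w oT.
have : (\sum_i intercepts w (i, t) <= 1)%N.
  by have := sum_intercepts_slice w t; rewrite wt.
have : (\sum_(s | s != t) \sum_i intercepts w (i, s) <= \sum_(s | s != t) 2)%N.
  by apply: leq_sum => s _; apply: leq_trans (sum_intercepts_slice w s) _; case: eqP.
rewrite [in X in _ -> _ -> X](bigD1 t) //= sum_nat_neq_const card_ord; lia.
Qed.

Lemma oscillation_count (a : attack 'I_n T) : ~~ odd n ->
  ((2 * T).-1 <= \sum_(c : 'I_n * 'I_T) intercepts (oscillation c.1 c.2) a)%N.
Proof.
case: a => i t even_n.
rewrite -(pair_bigA _ (fun j s => intercepts (oscillation j s) (i, t) : nat)) /=.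
rewrite (bigD1 i) //= (bigD1 (mate i)) ?mate_neq //=.
have -> : (\sum_s intercepts (oscillation i s) (i, t) = T)%N.
  under eq_bigr do rewrite oscillation_base.
  by rewrite sum1_card card_ord.
(* Patrols based at [mate i] reach [i] as the mate of their base; only the one pausing during the
   attack is discounted. *)
have : (\sum_(s | s != ordS t) 1 <=
        \sum_s intercepts (oscillation (mate i) s) (i, t))%N.
  rewrite [leqRHS](bigD1 (ordS t)) //=; apply: leq_trans (leq_addl _ _).
  apply: leq_sum => s st; rewrite -{2}[i](mateK even_n) oscillation_mate //.
  by rewrite (negPf st) andbF.
rewrite sum_nat_neq_const card_ord => count_mate.
apply: (@leq_trans (T + T.-1 * 1)); first lia.
rewrite leq_add2l; exact: leq_trans count_mate (leq_addr _ _).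
Qed.

Lemma oscillation_even_node_count (s : 'I_T) (a : attack 'I_n T) : ~~ odd T ->
  (1 <= \sum_k intercepts (oscillation (even_node k) s) a)%N.
Proof.
case: a => i t even_T; have [k ik] := half_node_cover i.
rewrite (bigD1 k) //= (_ : intercepts _ _) //.
by case: ik => ->; [exact: oscillation_base | rewrite oscillation_mate // (negPf even_T)].
Qed.

End Patrols.
End Line.

Theorem proposition6 (R : realFieldType) (T n : nat) (V : R)
    (hT : (2 <= T)%N) (hn : (2 <= n)%N) :
  (~~ odd T ->
     (patrolling_game_value (@line_graph n) T V <->
        V = 1 / (covering_number (@line_graph n))%:R) /\
     (1 / (covering_number (@line_graph n))%:R =
        if odd n then 2 / (n%:R + 1) else 2 / n%:R :> R)) /\
  (odd T -> ~~ odd n ->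
     (patrolling_game_value (@line_graph n) T V <->
        V = (2 * T%:R - 1) / (n%:R * T%:R))).
Proof.
split=> [even_T|odd_T even_n].
  have s0 : 'I_T by exists 0%N; lia.
  rewrite covering_number_line //; split.
    rewrite -[uphalf n]card_ord.
    apply: (game_value_uniform (r := @intercepts _ (@line_graph n) T)
             (f := fun k => oscillation hn (even_node k) s0)
             (g := fun k => (even_node k, s0)) (c := 1)).
    - by rewrite card_ord; lia.
    - by move=> a; apply: oscillation_even_node_count.
    - by move=> w; apply: sum_intercepts_even_node.
  (* [2 * uphalf n] is [n] or [n + 1] according to parity. *)
  have -> : (if odd n then 2 / (n%:R + 1) else 2 / n%:R) = 2 / (2 * uphalf n)%:R :> R.
    by case: ifP => odd_n; rewrite ?natr1; congr (_ / _%:R); lia.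
  by rewrite natrM invfM mulrA divff ?pnatr_eq0.
have -> : (2 * T%:R - 1) / (n%:R * T%:R) =
          ((2 * T).-1)%:R / #|{: 'I_n * 'I_T}|%:R :> R.
  rewrite card_prod !card_ord natrM -subn1 natrB ?natrM //; lia.
(* A pair in ['I_n * 'I_T] serves as base and start of a patrol, and as node and time of an
   attack. *)
apply: (game_value_uniform (r := @intercepts _ (@line_graph n) T)
         (f := fun c : 'I_n * 'I_T => oscillation hn c.1 c.2)
         (g := id)).
- by rewrite card_prod !card_ord; lia.
- by move=> a; apply: oscillation_count.
- by move=> w; apply: sum_intercepts.
Qed.
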